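(* There is a one-to-one correspondence between the NBA equivalence classes of irrational lattices in $\mathbb{R}^2$ and two-sided sequences of positive integers up to re-indexing or transposing. It is induced by assigning to a sequence $(a_i)_{i\in\mathbb{Z}}$ the lattice generated by $(1,1)$ and $(-\Delta,-\widetilde\Delta)$, where $\Delta=[a_0,a_1,a_2,\dots]$ and $-\widetilde\Delta=[0,a_{-1},a_{-2},\dots]$.
   Context: A lattice in $\mathbb{R}^2$ is $A\mathbb{Z}^2$ for an invertible real $2\times 2$ matrix $A$; it is irrational if no two of its distinct points lie on the same horizontal or vertical line. Square brackets denote continued fractions. Two invertible real $2\times2$ matrices are NBA (normalized box area) equivalent if one is obtained from the other by a finite sequence of the operations: multiplication from the left by a diagonal matrix $\mathrm{diag}(a,b)$ with $ab\ne0$; multiplication from the left by $\begin{pmatrix}0&1\\1&0\end{pmatrix}$; multiplication from the right by a matrix in $\mathrm{GL}_2(\mathbb{Z})$. Two lattices are NBA equivalent if they have NBA equivalent generating matrices. Two sequences are identified up to re-indexing or transposing if one is obtained from the other by shifts $(a_i)\mapsto(a_{i+m})$, $m\in\mathbb{Z}$, and reversal $(a_i)\mapsto(a_{-i})$. *)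

(* Defs.v *)
From HB Require Import structures.
From Stdlib Require Import Relation_Operators.
From mathcomp Require Import all_boot all_order all_algebra.
From mathcomp Require Import all_classical all_reals all_analysis.
Set Implicit Arguments.
Unset Strict Implicit.
Unset Printing Implicit Defensive.
Import Order.TTheory GRing.Theory Num.Theory.
Import numFieldNormedType.Exports.
Local Open Scope classical_set_scope.
Local Open Scope ring_scope.

Section EquivalenceClasses.
Variables (T : Type) (D : set T) (E : T -> T -> Prop).

Definition eqclass (x : T) : set T := [set y | D y /\ E x y].

Definition eqclasses : set (set T) := [set eqclass x | x in D].

End EquivalenceClasses.

Section Lattices.
Variable R : realType.

Definition lattice (A : 'M[R]_2) : set 'cV[R]_2 :=
  [set A *m map_mx intr z | z in [set: 'cV[int]_2]].

Definition is_lattice (L : set 'cV[R]_2) : Prop :=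
  exists2 A : 'M[R]_2, A \in unitmx & L = lattice A.

Definition irrational_set (L : set 'cV[R]_2) : Prop :=
  forall p q, L p -> L q -> p <> q -> p 0 0 <> q 0 0 /\ p 1 0 <> q 1 0.

Definition irrational_lattice : set (set 'cV[R]_2) :=
  [set L | is_lattice L /\ irrational_set L].

Inductive nba_step (A : 'M[R]_2) : 'M[R]_2 -> Prop :=
| nba_diag (d : 'rV[R]_2) of d 0 0 * d 0 1 != 0 :
    nba_step A (diag_mx d *m A)
| nba_swap : nba_step A (tperm_mx 0 1 *m A)
| nba_GL2Z (U : 'M[int]_2) of U \in unitmx :
    nba_step A (A *m map_mx intr U).

(* Every step can be undone by a step, so the reflexive-transitive closure is
   already symmetric. *)
Definition nba_equiv_mx : 'M[R]_2 -> 'M[R]_2 -> Prop :=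
  clos_refl_trans 'M[R]_2 nba_step.

Definition nba_equiv (L L' : set 'cV[R]_2) : Prop :=
  exists A B : 'M[R]_2, [/\ A \in unitmx, B \in unitmx,
    L = lattice A, L' = lattice B & nba_equiv_mx A B].

Definition nba_class : set 'cV[R]_2 -> set (set 'cV[R]_2) :=
  eqclass irrational_lattice nba_equiv.

Definition nba_classes : set (set (set 'cV[R]_2)) :=
  eqclasses irrational_lattice nba_equiv.

(* [x 0, x 1, ..., x n] *)
Fixpoint convergent (x : nat -> nat) (n : nat) : R :=
  if n is m.+1 then (x 0%N)%:R + (convergent (fun k => x k.+1) m)^-1
  else (x 0%N)%:R.

(* Meaningful when x k > 0 for all k > 0: the convergents then converge. *)
Definition cfrac (x : nat -> nat) : R := limn (convergent x).

Definition Delta (a : int -> nat) : R := cfrac (fun n => a n%:Z).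

Definition Delta_tilde (a : int -> nat) : R :=
  - cfrac (fun n => if n is 0 then 0%N else a (- n%:Z)).

Definition vec2 (x y : R) : 'cV[R]_2 := \col_i (if i == 0 then x else y).

Definition seq_lattice (a : int -> nat) : set 'cV[R]_2 :=
  lattice (row_mx (vec2 1 1) (vec2 (- Delta a) (- Delta_tilde a))).

End Lattices.

Arguments nba_classes R : clear implicits.

Definition positive_seq : set (int -> nat) := [set a | forall i, (0 < a i)%N].

Inductive seq_step (a : int -> nat) : (int -> nat) -> Prop :=
| seq_shift (m : int) : seq_step a (fun i => a (i + m))
| seq_reverse : seq_step a (fun i => a (- i)).

Definition seq_equiv : (int -> nat) -> (int -> nat) -> Prop :=
  clos_refl_trans (int -> nat) seq_step.

Definition seq_class : (int -> nat) -> set (int -> nat) :=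
  eqclass positive_seq seq_equiv.

Definition seq_classes : set (set (int -> nat)) :=
  eqclasses positive_seq seq_equiv.

(* Main.v *)
Require Import Defs.
From Stdlib Require Import Relation_Operators.
From mathcomp Require Import all_boot all_order all_algebra.
From mathcomp Require Import all_classical all_reals all_analysis.
From mathcomp Require Import perm ring lra zify.
Set Implicit Arguments.
Unset Strict Implicit.
Unset Printing Implicit Defensive.
Import Order.TTheory GRing.Theory Num.Theory.
Import numFieldNormedType.Exports.
Local Open Scope classical_set_scope.
Local Open Scope ring_scope.

(** NBA equivalence says that one lattice is the image of the other under
    an invertible diagonal or antidiagonal matrix ([nba_equivP]). Up to a
    diagonal matrix, an irrational lattice consists of the points
    (x - s y, x - t y) with x, y integers, where s and t are distinct
    irrational numbers ([form_lattice]). For every integer n the change of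
    coordinates from (x, y) to (y, x - n y) replaces (s, t) by
    (1/(s - n), 1/(t - n)) ([form_lattice_step]).

    For the pair s = Delta a, t = Delta_tilde a this step with n = a 0 is
    the shift of the sequence by one ([form_lattice_shift1]), and the
    reversal of the sequence comes from exchanging s and t and replacing
    each number z by a 0 - z ([form_lattice_reflect]). So the lattice class
    depends only on the class of the sequence ([nba_equiv_seq_lattice]).

    Surjectivity. A pair with s > 1 and -1 < t < 0 comes from a sequence:
    expand s and -1/t into continued fractions ([coded_reduced]). Any pair
    is brought to this form by steps with n the integer part of s. As soon
    as t does not have the same integer part as s, boundedly many steps
    suffice. While s and t keep the same integer part, the inverse of the
    distance |1/s - 1/t| drops by at least one in each step, so this lasts
    only finitely long ([coded_gt1]).

    Injectivity. A pair with s > 1 and -1 < t < 0 gives a basis of the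
    lattice, u = (c, d) and v = (-c s, -d t), such that the box
    |p_0| <= |v_0|, |p_1| <= |u_1| contains no nonzero lattice points but +-u and
    +-v ([form_box]). Given two such bases with |u_0| < |v'_0| <= |v_0|,
    each box contains vectors of the other basis, and the bases agree up
    to signs ([reduced_frame_unique]). The shifts of a form a chain of
    such bases of the same lattice in which |u_0| tends to zero in one
    direction and to infinity in the other, so every basis of this kind
    interlaces with one of them ([framed_interlaced]). Hence lattices with
    a common class come from sequences that differ by a shift and possibly
    a reversal ([seq_equiv_of_nba]). *)

(** * Convergence, uniqueness and existence of continued fractions *)

Section ContinuedFractions.
Variable R : realType.
Implicit Types (x y : nat -> nat) (s t : R) (n m : nat).

(** The reciprocal 1/(x_0 + 1/(x_1 + ... + 1/(x_(n-1) + t))).  Reciprocals of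
    complete quotients stay in [0, 1], where the estimates below are uniform;
    the quotients themselves are unbounded. *)
Fixpoint cftail x n t : R :=
  if n is m.+1 then ((x 0%N)%:R + cftail (fun k => x k.+1) m t)^-1 else t.

Lemma cftail_itv x n t : (forall k, (0 < x k)%N) -> 0 <= t <= 1 ->
  0 <= cftail x n t <= 1.
Proof.
elim: n x => [//|n IH] x x_gt0 t01 /=.
have /andP[K_ge0 K_le1] := IH (fun k => x k.+1) (fun k => x_gt0 k.+1) t01.
have x0_ge1 : 1 <= (x 0%N)%:R :> R by rewrite ler1n.
by rewrite invr_ge0 invf_le1; [apply/andP; split; lra | lra].
Qed.

(** On [0, 1] the maps s |-> 1/(a + s) have no common Lipschitz constant below
    1, but the distance D of two points shrinks to at most D/(1 + D), that is,
    1/D grows by at least 1.  This gives the convergence of continued fractions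
    and, read backwards, the termination of the reduction of a pair. *)
Lemma inv_contraction (a s t : R) : 1 <= a -> 0 <= s -> 0 <= t ->
  `|(a + s)^-1 - (a + t)^-1| <= `|s - t| / (1 + `|s - t|).
Proof.
move=> a_ge1 s_ge0 t_ge0.
have as_gt0 : 0 < a + s by lra.
have at_gt0 : 0 < a + t by lra.
have -> : (a + s)^-1 - (a + t)^-1 = (t - s) * ((a + s) * (a + t))^-1.
  by field; rewrite !gt_eqF.
rewrite normrM distrC ler_wpM2l //.
have prod_gt0 : 0 < (a + s) * (a + t) by rewrite mulr_gt0.
rewrite (gtr0_norm (x := _^-1)) ?invr_gt0 // lef_pV2 ?posrE ?ltr_pwDl //.
have prod_ge : 1 + s + t <= (a + s) * (a + t).
  have -> : (a + s) * (a + t)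
      = 1 + s + t + (a - 1) * (a + 1 + s + t) + s * t by ring.
  by rewrite -[leRHS]addrA lerDl addr_ge0 // mulr_ge0 //; lra.
by case: (ger0P (s - t)) => st; lra.
Qed.

(** Iterating D |-> D/(1 + D) from D <= 1 gives 1/(n + 1) after n steps. *)
Lemma cftail_dist x n s t : (forall k, (0 < x k)%N) ->
  0 <= s <= 1 -> 0 <= t <= 1 ->
  `|cftail x n s - cftail x n t| <= n.+1%:R^-1.
Proof.
move=> + s01 t01; elim: n x => [|n IH] x x_gt0 /=.
  by rewrite invr1; case: (ger0P (s - t)) => st; lra.
set y := fun k => x k.+1.
have y_gt0 k : (0 < y k)%N by exact: x_gt0.
have /andP[Ks_ge0 _] := cftail_itv n y_gt0 s01.
have /andP[Kt_ge0 _] := cftail_itv n y_gt0 t01.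
have x0_ge1 : 1 <= (x 0%N)%:R :> R by rewrite ler1n.
apply: le_trans (inv_contraction x0_ge1 Ks_ge0 Kt_ge0) _.
have := IH y y_gt0; set d := `|_|; have d_ge0 : 0 <= d by exact: normr_ge0.
have n_gt0 : 0 < n.+1%:R :> R by rewrite ltr0Sn.
rewrite -[n.+2]addn1 natrD => d_le.
rewrite ler_pdivrMr ?ltr_pwDl // mulrC ler_pdivlMr ?ltr_wpDl //.
move: d_le; rewrite -(ler_pM2r n_gt0) mulVf ?gt_eqF // => d_le.
by lra.
Qed.

Lemma convergentE x n :
  convergent R x n = (x 0%N)%:R + cftail (fun k => x k.+1) n 0.
Proof.
elim: n x => [|n IH] x /=; first by rewrite addr0.
by rewrite IH.
Qed.

Lemma cftail_split x n m t : (forall k, (0 < x k)%N) -> 0 <= t <= 1 ->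
  exists2 s, 0 <= s <= 1 & cftail x (n + m) t = cftail x n s.
Proof.
elim: n x => [|n IH] x x_gt0 t01 /=.
  by exists (cftail x m t) => //; exact: cftail_itv.
have [s s01 ->] := IH (fun k => x k.+1) (fun k => x_gt0 k.+1) t01.
by exists s.
Qed.

Lemma is_cvg_convergent x : (forall k, (0 < x k.+1)%N) ->
  cvgn (convergent R x).
Proof.
move=> x_gt0; apply: cauchy_cvg; apply: cauchy_exP => e e_gt0.
have [N _ /(_ N (leqnn N)) Ne] := near_infty_natSinv_lt (PosNum e_gt0).
exists (convergent R x N).
exists N => // n /= /subnKC <-.
rewrite /ball /= !convergentE opprD addrACA subrr add0r.
have [s s01 ->] := @cftail_split (fun k => x k.+1) N (n - N) 0 x_gt0
  (introT andP (conj (lexx 0) ler01)).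
apply: le_lt_trans Ne; apply: cftail_dist => //.
by rewrite lexx ler01.
Qed.

(** A sequence of complete quotients for x identifies the value of the
    continued fraction: its head and the n-th convergent arise from the same
    first n digits, so they are at distance at most 1/(n + 1). *)
Lemma cfrac_unique x (u : nat -> R) :
  (forall k, (0 < x k.+1)%N) -> (forall n, 1 <= u n.+1) ->
  (forall n, u n = (x n)%:R + (u n.+1)^-1) -> cfrac R x = u 0%N.
Proof.
move=> x_gt0 u_ge1 uE.
have u01 n : 0 <= (u n.+1)^-1 <= 1.
  have := u_ge1 n => u1.
  by rewrite invr_ge0 invf_le1 ?u1 ?andbT; lra.
have tailE n m : cftail (fun k => x (m + k).+1) n (u (n + m).+1)^-1
    = (u m.+1)^-1.
  elim: n m => [|n IH] m //=.
  rewrite addn0 [in RHS]uE; congr (_ + _)^-1.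
  rewrite -(IH m.+1) addSnnS; congr cftail.
  by apply/funext => k; rewrite addSnnS.
apply/cvg_lim; first exact: Rhausdorff.
apply/cvgrPdist_lt => e e_gt0.
have [N _ Ne] := near_infty_natSinv_lt (PosNum e_gt0).
exists N => // n /= Nn.
rewrite uE convergentE opprD addrACA subrr add0r -(tailE n 0%N).
apply: le_lt_trans (Ne n Nn); apply: cftail_dist => //.
by rewrite lexx ler01.
Qed.

Lemma cfrac_ge1 x : (forall k, (0 < x k)%N) -> 1 <= cfrac R x.
Proof.
move=> x_gt0; apply: limr_ge; first exact: is_cvg_convergent.
apply: nearW => n; rewrite convergentE.
have /andP[] := @cftail_itv (fun k => x k.+1) n 0 (fun k => x_gt0 k.+1)
  (introT andP (conj (lexx 0) ler01)).
have : 1 <= (x 0%N)%:R :> R by rewrite ler1n.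
by lra.
Qed.

Lemma cfrac_rec x : (forall k, (0 < x k.+1)%N) ->
  cfrac R x = (x 0%N)%:R + (cfrac R (fun k => x k.+1))^-1.
Proof.
move=> x_gt0; apply/cvg_lim; first exact: Rhausdorff.
rewrite -cvg_shiftS /=; apply: cvgD; first exact: cvg_cst.
apply: cvgV; first by have := cfrac_ge1 x_gt0 => ?; rewrite gt_eqF //; lra.
by apply: is_cvg_convergent => k; exact: x_gt0.
Qed.

Lemma cfrac_gt1 x : (forall k, (0 < x k)%N) -> 1 < cfrac R x.
Proof.
move=> x_gt0; rewrite cfrac_rec //.
have : 1 <= (x 0%N)%:R :> R by rewrite ler1n.
have := @cfrac_ge1 (fun k => x k.+1) (fun k => x_gt0 k.+1) => y_ge1.
by have : 0 < (cfrac R (fun k => x k.+1))^-1 by [rewrite invr_gt0; lra]; lra.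
Qed.

Lemma cfrac_itv x : (forall k, (0 < x k.+1)%N) ->
  (x 0%N)%:R < cfrac R x < (x 0%N)%:R + 1.
Proof.
move=> x_gt0; rewrite cfrac_rec //.
have := @cfrac_gt1 (fun k => x k.+1) x_gt0 => y_gt1.
have y_gt0 : 0 < cfrac R (fun k => x k.+1) by lra.
by rewrite ltrDl invr_gt0 y_gt0 ltrD2l invf_lt1.
Qed.

Lemma cfrac_inj x y :
  (forall k, (0 < x k.+1)%N) -> (forall k, (0 < y k.+1)%N) ->
  cfrac R x = cfrac R y -> x =1 y.
Proof.
have head z : (forall k, (0 < z k.+1)%N) -> Num.truncn (cfrac R z) = z 0%N.
  move=> z_gt0; apply: truncn_def.
  by have /andP[z1 z2] := cfrac_itv z_gt0; rewrite ltW // -natr1.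
move=> + + + n; elim: n x y => [|n IH] x y x_gt0 y_gt0 xy.
  by rewrite -head // xy head.
apply: (IH (fun k => x k.+1) (fun k => y k.+1)) => //.
have x0y0 : x 0%N = y 0%N by rewrite -head // xy head.
by move: xy; rewrite (cfrac_rec x_gt0) (cfrac_rec y_gt0) x0y0
  => /addrI/invr_inj.
Qed.

(** Irrationality, in the form in which it says that the integer form p - q t
    has no nontrivial zero. *)
Definition irr t := forall p q : int, p%:~R = q%:~R * t -> q = 0.

Lemma irr_neq_int s (n : int) : irr s -> s != n%:~R.
Proof.
move=> s_irr; apply/eqP => sn; have := s_irr n 1.
by rewrite mul1r => /(_ (esym sn)).
Qed.

Lemma irr_sub_inv t (n : int) : irr t -> irr (t - n%:~R)^-1.
Proof.
move=> t_irr p q pq.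
have tn0 : t - n%:~R != 0 by rewrite subr_eq0 irr_neq_int.
have pq' : q%:~R = p%:~R * (t - n%:~R) by rewrite pq mulfVK.
have p0 : p = 0.
  by apply: (t_irr (q + p * n) p); rewrite intrD intrM pq'; ring.
by apply: (t_irr 0); move: pq'; rewrite p0 mul0r => ->; rewrite mul0r.
Qed.

Lemma irrN t : irr t -> irr (- t).
Proof.
move=> t_irr p q pq; apply: (t_irr (- p) q).
by rewrite intrN pq; ring.
Qed.

(** Descent on the denominator: if the value is p/q, then the value of the
    shifted sequence is q/r with r = p - q x_0, and 0 < r < q because that value
    exceeds 1. *)
Lemma irr_cfrac x : (forall k, (0 < x k.+1)%N) -> irr (cfrac R x).
Proof.
suff pos q p : (forall k, (0 < x k.+1)%N) ->
    p%:~R = q%:R * cfrac R x -> q = 0%N.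
  move=> x_gt0 p [] q; first by move/pos => ->.
  rewrite NegzE intrN mulNr => /(congr1 -%R); rewrite opprK -intrN.
  by move/pos => /(_ x_gt0).
elim/ltn_ind: q p x => q IH p x x_gt0 pq.
case: q => [//|q] in IH pq *; exfalso.
set t := cfrac R x in pq; set y := fun k => x k.+1.
have y_gt1 : 1 < cfrac R y by exact: cfrac_gt1.
have tE : t = (x 0%N)%:R + (cfrac R y)^-1 by exact: cfrac_rec.
have y_neq0 : cfrac R y != 0 by rewrite gt_eqF //; lra.
have rE : (p - q.+1%:Z * (x 0%N)%:Z)%:~R = q.+1%:R / cfrac R y.
  by rewrite intrB intrM pq tE; ring.
have q_gt0 : 0 < q.+1%:R :> R by rewrite ltr0Sn.
have r_gt0 : 0 < (p - q.+1%:Z * (x 0%N)%:Z).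
  by rewrite -(ltr0z R) rE divr_gt0 //; lra.
case: (p - _) r_gt0 rE => // r r_gt0 rE.
have r0 : r = 0%N.
  apply: (IH r _ q.+1 y) => [|k|].
  - rewrite -(ltr_nat R) [X in X < _]rE ltr_pdivrMr; last by lra.
    by rewrite ltr_pMr.
  - exact: x_gt0.
  - by rewrite [r%:R]rE mulfVK.
by rewrite r0 in r_gt0.
Qed.

Lemma floor_irr_itv s : irr s ->
  (Num.floor s)%:~R < s < (Num.floor s)%:~R + 1.
Proof.
move=> s_irr; have /andP[fl_le fl_gt] := floor_itv s.
rewrite lt_neqAle fl_le andbT eq_sym irr_neq_int //=.
by rewrite -intrD1.
Qed.

(** The digits are the integer parts along the orbit of t under
    s |-> 1/(s - floor s); irrationality keeps this orbit defined and above
    1. *)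
Lemma cfrac_surj t : irr t -> 1 < t ->
  exists2 x, (forall k, (0 < x k)%N) & cfrac R x = t.
Proof.
move=> t_irr t_gt1.
pose u n := iter n (fun s => (s - (Num.floor s)%:~R)^-1) t.
have u_spec n : irr (u n) /\ 1 < u n.
  elim: n => [//|n [un_irr un_gt1]]; split; first exact: irr_sub_inv.
  rewrite /u iterS -/(u n).
  have /andP[fl_lt fl_gt] := floor_irr_itv un_irr.
  by rewrite invf_gt1; lra.
have fl_gt0 n : 0 < Num.floor (u n).
  by rewrite floor_gt0 ltW //; case: (u_spec n).
exists (fun n => `|Num.floor (u n)|%N) => [k|].
  by rewrite absz_gt0 gt_eqF.
apply: (cfrac_unique (u := u)) => [k|n|n].
- by rewrite absz_gt0 gt_eqF.
- by rewrite ltW //; case: (u_spec n.+1).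
- rewrite {3}/u iterS -/(u n) invrK.
  rewrite -[X in X + _]/((`|Num.floor (u n)|%N%:Z)%:~R) gtz0_abs //.
  by rewrite addrC subrK.
Qed.

End ContinuedFractions.

(** * Lattices as values of two linear forms, and NBA equivalence *)

Section PlaneLattices.
Variable R : realType.
Implicit Types (c d s t : R) (A B T : 'M[R]_2) (L : set 'cV[R]_2) (n : int).

Definition mx2 a b c d : 'M[R]_2 :=
  \matrix_(i, j) if i == 0 then if j == 0 then a else b
                 else if j == 0 then c else d.

Lemma mx2P A B : A 0 0 = B 0 0 -> A 0 1 = B 0 1 -> A 1 0 = B 1 0 ->
  A 1 1 = B 1 1 -> A = B.
Proof.
move=> h00 h01 h10 h11; apply/matrixP => i j.
have ord2 (k : 'I_2) : k = 0 \/ k = 1.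
  by case: k => [[|[|//]] ?]; [left|right]; exact: val_inj.
by case: (ord2 i) => ->; case: (ord2 j) => ->.
Qed.

Lemma cV2P (p q : 'cV[R]_2) : p 0 0 = q 0 0 -> p 1 0 = q 1 0 -> p = q.
Proof.
move=> h0 h1; apply/matrixP => i j; rewrite ord1.
by case: i => [[|[|//]] ?]; [move: h0|move: h1]; congr (p _ _ = q _ _);
  exact: val_inj.
Qed.

Lemma vec2_0 (a b : R) : vec2 a b 0 0 = a. Proof. by rewrite mxE. Qed.
Lemma vec2_1 (a b : R) : vec2 a b 1 0 = b. Proof. by rewrite mxE. Qed.

Lemma mulmx2_row0 A (p : 'cV[R]_2) :
  (A *m p) 0 0 = A 0 0 * p 0 0 + A 0 1 * p 1 0.
Proof.
by rewrite mxE big_ord_recl big_ord1; congr (_ * _ + A _ _ * p _ _);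
  exact: val_inj.
Qed.

Lemma mulmx2_row1 A (p : 'cV[R]_2) :
  (A *m p) 1 0 = A 1 0 * p 0 0 + A 1 1 * p 1 0.
Proof.
by rewrite mxE big_ord_recl big_ord1; congr (_ * _ + A _ _ * p _ _);
  exact: val_inj.
Qed.

Lemma mul_mx2 a b c d a' b' c' d' : mx2 a b c d *m mx2 a' b' c' d'
  = mx2 (a * a' + b * c') (a * b' + b * d') (c * a' + d * c') (c * b' + d * d').
Proof.
by apply: mx2P; rewrite !mxE big_ord_recl big_ord1 !mxE.
Qed.

Lemma mx2_1 : mx2 1 0 0 1 = 1%:M.
Proof. by apply: mx2P; rewrite !mxE. Qed.

Lemma diag_mx2 (u : 'rV[R]_2) : diag_mx u = mx2 (u 0 0) 0 0 (u 0 1).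
Proof. by apply: mx2P; rewrite !mxE. Qed.

Lemma tperm_mx2 : tperm_mx 0 1 = mx2 0 1 1 0.
Proof. by apply: mx2P; rewrite !mxE permE. Qed.

Lemma latticeP A p : lattice A p <-> exists x y : int,
  p = vec2 (A 0 0 * x%:~R + A 0 1 * y%:~R) (A 1 0 * x%:~R + A 1 1 * y%:~R).
Proof.
split=> [[z _ <-]|[x [y ->]]].
  exists (z 0 0), (z 1 0); apply: cV2P.
    by rewrite vec2_0 mulmx2_row0 !mxE.
  by rewrite vec2_1 mulmx2_row1 !mxE.
exists (\col_i if i == 0 then x else y) => //; apply: cV2P.
  by rewrite vec2_0 mulmx2_row0 !mxE.
by rewrite vec2_1 mulmx2_row1 !mxE.
Qed.

Lemma lattice_mulGL2Z A (U : 'M[int]_2) : U \in unitmx ->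
  lattice (A *m map_mx intr U) = lattice A.
Proof.
move=> U_unit; apply/seteqP; split=> p [z _ <-].
  by exists (U *m z) => //; rewrite map_mxM mulmxA.
by exists (invmx U *m z) => //; rewrite -mulmxA -map_mxM mulKVmx.
Qed.

Lemma lattice_mull T A : lattice (T *m A) = [set T *m p | p in lattice A].
Proof.
apply/seteqP; split=> p.
  by case=> z _ <-; exists (A *m map_mx intr z); [exists z|rewrite mulmxA].
by case=> _ [z _ <-] <-; exists z => //; rewrite mulmxA.
Qed.

(** The matrices through which the left operations of NBA equivalence act; the
    right operation does not change the lattice at all. *)
Definition monomial T := exists c d, c * d != 0 /\
  (T = mx2 c 0 0 d \/ T = mx2 0 c d 0).

Lemma monomialM T T' : monomial T -> monomial T' -> monomial (T *m T').
Proof.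
move=> [c [d [cd0 E]]] [c' [d' [cd0' E']]].
move: cd0 cd0'; rewrite !mulf_eq0 !negb_or => /andP[c0 d0] /andP[c0' d0'].
case: E => ->; case: E' => ->; rewrite mul_mx2 !(mul0r, mulr0, addr0, add0r).
- exists (c * c'), (d * d'); split; last by left.
  by rewrite !mulf_neq0.
- exists (c * c'), (d * d'); split; last by right.
  by rewrite !mulf_neq0.
- exists (c * d'), (d * c'); split; last by right.
  by rewrite !mulf_neq0.
- exists (c * d'), (d * c'); split; last by left.
  by rewrite !mulf_neq0.
Qed.

Lemma monomial1 : monomial 1%:M.
Proof. by exists 1, 1; rewrite mulr1 oner_eq0 -mx2_1; split=> //; left. Qed.

Lemma monomialV T : monomial T -> exists2 T', monomial T' & T' *m T = 1%:M.
Proof.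
move=> [c [d [cd0 E]]].
move: cd0; rewrite !mulf_eq0 !negb_or => /andP[c0 d0].
case: E => ->; [exists (mx2 c^-1 0 0 d^-1)|exists (mx2 0 d^-1 c^-1 0)].
- by exists c^-1, d^-1; rewrite mulf_neq0 ?invr_eq0 //; split=> //; left.
- by rewrite mul_mx2 !(mul0r, mulr0, addr0, add0r) !mulVf // mx2_1.
- by exists d^-1, c^-1; rewrite mulf_neq0 ?invr_eq0 //; split=> //; right.
- by rewrite mul_mx2 !(mul0r, mulr0, addr0, add0r) !mulVf // mx2_1.
Qed.

Lemma monomial_unit T : monomial T -> T \in unitmx.
Proof. by move=> /monomialV[T' _ /mulmx1_unit[]]. Qed.

Lemma nba_equiv_mx_lattice A B : nba_equiv_mx A B ->
  exists2 T, monomial T & lattice B = [set T *m p | p in lattice A].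
Proof.
elim=> {A B} [A _ [u u0||U U_unit]|A|A B C _ [T T_mon BE] _ [T' T'_mon CE]].
- exists (diag_mx u); last exact: lattice_mull.
  by exists (u 0 0), (u 0 1); split=> //; left; exact: diag_mx2.
- exists (tperm_mx 0 1); last exact: lattice_mull.
  exists 1, 1; rewrite mulr1 oner_eq0; split=> //; right; exact: tperm_mx2.
- exists 1%:M; first exact: monomial1.
  by rewrite lattice_mulGL2Z // -lattice_mull mul1mx.
- by exists 1%:M; [exact: monomial1|rewrite -lattice_mull mul1mx].
- exists (T' *m T); first exact: monomialM.
  rewrite CE BE; apply/seteqP; split=> q.
    by case=> _ [p Lp <-] <-; exists p => //; rewrite mulmxA.
  by case=> p Lp <-; exists (T *m p); [exists p|rewrite mulmxA].
Qed.

Lemma nba_equiv_mx_mull T A : monomial T -> nba_equiv_mx A (T *m A).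
Proof.
move=> [c [d [cd0 E]]].
pose u : 'rV[R]_2 := \row_j if j == 0 then c else d.
have u0 : u 0 0 * u 0 1 != 0 by rewrite !mxE.
case: E => ->.
  have -> : mx2 c 0 0 d = diag_mx u by rewrite diag_mx2 !mxE.
  by apply: rt_step; exact: nba_diag.
have -> : mx2 0 c d 0 = diag_mx u *m tperm_mx 0 1.
  rewrite diag_mx2 tperm_mx2 mul_mx2 !(mul0r, mulr0, addr0, add0r, mulr1).
  by rewrite !mxE.
rewrite -mulmxA; apply: rt_trans; first by apply: rt_step; exact: nba_swap.
by apply: rt_step; exact: nba_diag.
Qed.

Lemma nba_equivP L L' : nba_equiv L L' <->
  is_lattice L /\ exists2 T, monomial T & L' = [set T *m p | p in L].
Proof.
split=> [[A [B [A_unit _ -> -> /nba_equiv_mx_lattice AB]]]|].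
  by split=> //; exists A.
move=> [[A A_unit ->] [T T_mon ->]]; exists A, (T *m A); split=> //.
- by rewrite unitmx_mul monomial_unit.
- by rewrite lattice_mull.
- exact: nba_equiv_mx_mull.
Qed.

Lemma nba_equiv_sym L L' : nba_equiv L L' -> nba_equiv L' L.
Proof.
move=> /nba_equivP[[A A_unit ->] [T T_mon ->]]; apply/nba_equivP; split.
  by exists (T *m A); rewrite ?lattice_mull // unitmx_mul monomial_unit.
have [T' T'_mon T'T] := monomialV T_mon; exists T' => //.
by rewrite -!lattice_mull mulmxA T'T mul1mx.
Qed.

Lemma nba_equiv_trans L1 L2 L3 :
  nba_equiv L1 L2 -> nba_equiv L2 L3 -> nba_equiv L1 L3.
Proof.
move=> /nba_equivP[[A A_unit ->] [T T_mon ->]].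
move=> /nba_equivP[_ [T' T'_mon ->]]; apply/nba_equivP; split.
  by exists A.
exists (T' *m T); first exact: monomialM.
by rewrite -!lattice_mull mulmxA.
Qed.

(** The lattice generated by (c, d) and (-c s, -d t): the values of the linear
    forms x - s y and x - t y, rescaled by c and d.  Keeping the scale factors
    makes changes of basis into equalities of sets. *)
Definition form_lattice c d s t : set 'cV[R]_2 :=
  [set p | exists x y : int,
     p = vec2 (c * (x%:~R - s * y%:~R)) (d * (x%:~R - t * y%:~R))].

Lemma form_latticeE c d s t :
  form_lattice c d s t = lattice (mx2 c (- (c * s)) d (- (d * t))).
Proof.
apply/seteqP; split=> p; rewrite latticeP !mxE /=.
  by move=> [x [y ->]]; exists x, y; congr vec2; ring.
by move=> [x [y ->]]; exists x, y; congr vec2; ring.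
Qed.

Lemma seq_latticeE a :
  seq_lattice a = form_lattice 1 1 (Delta R a) (Delta_tilde R a).
Proof.
rewrite form_latticeE /seq_lattice; congr lattice; rewrite !mul1r.
by apply: mx2P; rewrite !mxE; case: splitP => -[[|//] ?] //= _; rewrite !mxE.
Qed.

Lemma is_lattice_form c d s t : c != 0 -> d != 0 -> s != t ->
  is_lattice (form_lattice c d s t).
Proof.
move=> c0 d0 st; rewrite form_latticeE; eexists; last by [].
have e0 : c * d * (s - t) != 0 by rewrite !mulf_neq0 // subr_eq0.
pose e := c * d * (s - t).
have : mx2 (- (d * t) / e) (c * s / e) (- d / e) (c / e)
    *m mx2 c (- (c * s)) d (- (d * t)) = 1%:M.
  rewrite mul_mx2 -mx2_1; congr mx2; rewrite /e; field;
  by rewrite ?c0 ?d0 ?subr_eq0 ?st.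
by case/mulmx1_unit.
Qed.

(** The substitution (x, y) = (Y + n X, X), together with
    x - s y = (n - s) (X - Y / (s - n)). *)
Lemma form_lattice_step c d s t n : s != n%:~R -> t != n%:~R ->
  form_lattice c d s t = form_lattice (c * (n%:~R - s)) (d * (n%:~R - t))
    (s - n%:~R)^-1 (t - n%:~R)^-1.
Proof.
rewrite -(subr_eq0 s) -(subr_eq0 t) => s0 t0.
apply/seteqP; split=> p [x [y ->]].
  by exists y, (x - n * y); congr vec2; rewrite intrB intrM; field;
    rewrite ?s0 ?t0.
by exists (y + n * x), x; congr vec2; rewrite intrD intrM; field;
  rewrite ?s0 ?t0.
Qed.

Lemma nba_equiv_form c d c' d' s t : c != 0 -> d != 0 -> c' != 0 -> d' != 0 ->
  s != t -> nba_equiv (form_lattice c d s t) (form_lattice c' d' s t).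
Proof.
move=> c0 d0 c0' d0' st; apply/nba_equivP; split; first exact: is_lattice_form.
exists (mx2 (c' / c) 0 0 (d' / d)).
  exists (c' / c), (d' / d); split; last by left.
  by rewrite !mulf_neq0 ?invr_eq0.
rewrite !form_latticeE -lattice_mull mul_mx2; congr lattice.
by congr mx2; field.
Qed.

End PlaneLattices.

(** * The lattice of a two-sided sequence *)

Section TwoSidedSequences.
Variable R : realType.
Implicit Types (a b : int -> nat) (c d s t : R).

Definition shift_seq (m : int) a : int -> nat := fun i => a (i + m).
Definition reverse_seq a : int -> nat := fun i => a (- i).

Lemma positive_shift m a : positive_seq a -> positive_seq (shift_seq m a).
Proof. by move=> a_gt0 i; exact: a_gt0. Qed.

Lemma positive_reverse a : positive_seq a -> positive_seq (reverse_seq a).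
Proof. by move=> a_gt0 i; exact: a_gt0. Qed.

Lemma shift_seq0 a : shift_seq 0 a = a.
Proof. by apply/funext => i; rewrite /shift_seq addr0. Qed.

Lemma shift_seqD m n a : shift_seq m (shift_seq n a) = shift_seq (m + n) a.
Proof. by apply/funext => i; rewrite /shift_seq addrA. Qed.

Definition past a : nat -> nat := fun k => a (- k.+1%:Z).
Definition future a : nat -> nat := fun k => a k.+1%:Z.

Lemma Delta_rec a : positive_seq a ->
  Delta R a = (a 0)%:R + (cfrac R (future a))^-1.
Proof. by move=> a_gt0; rewrite /Delta cfrac_rec. Qed.

Lemma Delta_tilde_rec a : positive_seq a ->
  Delta_tilde R a = - (cfrac R (past a))^-1.
Proof. by move=> a_gt0; rewrite /Delta_tilde cfrac_rec //= add0r. Qed.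

Lemma Delta_gt1 a : positive_seq a -> 1 < Delta R a.
Proof. by move=> a_gt0; exact: cfrac_gt1. Qed.

Lemma Delta_itv a : positive_seq a ->
  (a 0)%:R < Delta R a < (a 0)%:R + 1.
Proof. by move=> a_gt0; exact: cfrac_itv. Qed.

Lemma Delta_tilde_itv a : positive_seq a -> -1 < Delta_tilde R a < 0.
Proof.
move=> a_gt0; rewrite Delta_tilde_rec // ltrN2 oppr_lt0 andbC.
have p_gt1 : 1 < cfrac R (past a) by apply: cfrac_gt1 => k; exact: a_gt0.
by rewrite invr_gt0 invf_lt1; [apply/andP; split; lra|lra].
Qed.

Lemma irr_Delta a : positive_seq a -> irr (Delta R a).
Proof. by move=> a_gt0; exact: irr_cfrac. Qed.

Lemma irr_Delta_tilde a : positive_seq a -> irr (Delta_tilde R a).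
Proof.
move=> a_gt0; rewrite Delta_tilde_rec //; apply: irrN.
have p_irr : irr (cfrac R (past a)) by apply: irr_cfrac => k; exact: a_gt0.
by have := irr_sub_inv (n := 0) p_irr; rewrite mulr0z subr0.
Qed.

Lemma Delta_shift1 a : positive_seq a ->
  Delta R (shift_seq 1 a) = (Delta R a - (a 0)%:R)^-1.
Proof.
move=> a_gt0; rewrite (Delta_rec a_gt0) addrC addKr invrK; congr cfrac.
by apply/funext => k; rewrite /shift_seq /future -PoszD addn1.
Qed.

(** Shifting moves the digit a 0 from the future to the head of the past, so
    that both numbers undergo the same fractional linear map. *)
Lemma Delta_tilde_shift1 a : positive_seq a ->
  Delta_tilde R (shift_seq 1 a) = (Delta_tilde R a - (a 0)%:R)^-1.
Proof.
move=> a_gt0; rewrite (Delta_tilde_rec (positive_shift 1 a_gt0)).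
rewrite -[LHS]invrN; congr _^-1.
rewrite cfrac_rec => [|k]; last exact: a_gt0.
have -> : (fun k => past (shift_seq 1 a) k.+1) = past a.
  by apply/funext => k; rewrite /past /shift_seq; congr (a _); lia.
have -> : past (shift_seq 1 a) 0%N = a 0 by rewrite /past /shift_seq addNr.
by rewrite Delta_tilde_rec // opprD addrC.
Qed.

Lemma Delta_reverse a : positive_seq a ->
  Delta R (reverse_seq a) = (a 0)%:R - Delta_tilde R a.
Proof.
move=> a_gt0; rewrite (Delta_rec (positive_reverse a_gt0)).
by rewrite Delta_tilde_rec // opprK /reverse_seq oppr0.
Qed.

Lemma Delta_tilde_reverse a : positive_seq a ->
  Delta_tilde R (reverse_seq a) = (a 0)%:R - Delta R a.
Proof.
move=> a_gt0; rewrite (Delta_tilde_rec (positive_reverse a_gt0)).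
by rewrite Delta_rec // opprD addrA subrr add0r.
Qed.

Lemma Delta_inj a b : positive_seq a -> positive_seq b ->
  Delta R a = Delta R b -> Delta_tilde R a = Delta_tilde R b -> a = b.
Proof.
move=> a_gt0 b_gt0 ab; rewrite !Delta_tilde_rec // => /oppr_inj/invr_inj pab.
apply/funext => -[k|k].
  by apply: (cfrac_inj _ _ ab) => i; [exact: a_gt0|exact: b_gt0].
by apply: (cfrac_inj _ _ pab) => i; [exact: a_gt0|exact: b_gt0].
Qed.

(** The product equals a_0 Delta(shift a) + 1.  So two shifts at least halve the
    scale of the first coordinate, although a single one need not shrink it by a
    definite factor. *)
Lemma Delta_mul_shift1 a : positive_seq a ->
  2 < Delta R a * Delta R (shift_seq 1 a).
Proof.
move=> a_gt0; have D1 := Delta_gt1 (positive_shift 1 a_gt0).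
have -> : Delta R a = (a 0)%:R + (Delta R (shift_seq 1 a))^-1.
  by rewrite Delta_shift1 // invrK addrC subrK.
rewrite mulrDl mulVf ?gt_eqF //; last by lra.
have : 1 <= (a 0)%:R :> R by rewrite ler1n.
by nra.
Qed.

Lemma form_lattice_shift1 a c d : positive_seq a ->
  form_lattice c d (Delta R a) (Delta_tilde R a) =
  form_lattice (c * ((a 0)%:R - Delta R a)) (d * ((a 0)%:R - Delta_tilde R a))
    (Delta R (shift_seq 1 a)) (Delta_tilde R (shift_seq 1 a)).
Proof.
move=> a_gt0; rewrite Delta_shift1 // Delta_tilde_shift1 //.
have h1 := Delta_itv a_gt0.
have /andP[h2 h3] := Delta_tilde_itv a_gt0.
have h4 : 0 <= (a 0)%:R :> R by [].
apply: (@form_lattice_step _ c d _ _ (a 0)).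
  by rewrite gt_eqF //; case/andP: h1.
by rewrite lt_eqF //; apply: lt_le_trans h4.
Qed.

(** The substitution (x, y) = (x' - n y', - y'). *)
Lemma form_lattice_reflect c d s t (n : int) :
  form_lattice c d s t = form_lattice c d (n%:~R - s) (n%:~R - t).
Proof.
apply/seteqP; split=> p [x [y ->]]; exists (x - n * y), (- y); congr vec2;
  rewrite intrB intrM intrN; ring.
Qed.

Lemma irrational_seq_lattice a : positive_seq a ->
  irrational_lattice (seq_lattice (R := R) a).
Proof.
move=> a_gt0; rewrite seq_latticeE; have D1 := Delta_gt1 a_gt0.
have /andP[_ D2] := Delta_tilde_itv a_gt0.
split; first by apply: is_lattice_form; rewrite ?oner_eq0 // gt_eqF //; lra.
have eq_of s x y x' y' : irr s -> 1 * (x%:~R - s * y%:~R) =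
    1 * (x'%:~R - s * y'%:~R) -> x = x' /\ y = y'.
  rewrite !mul1r => s_irr E.
  have /eqP : y - y' = 0.
    apply: (s_irr (x - x') (y - y')); rewrite !intrB.
    by move: E => /eqP; rewrite subr_eq => /eqP ->; ring.
  rewrite subr_eq0 => /eqP yy; split=> //; move: E; rewrite yy.
  by move/addIr/(mulrIz (@oner_neq0 R)).
move=> _ _ [x [y ->]] [x' [y' ->]] ne.
rewrite !vec2_0 !vec2_1; split=> E; apply: ne.
  by have [-> ->] := eq_of _ _ _ _ _ (irr_Delta a_gt0) E.
by have [-> ->] := eq_of _ _ _ _ _ (irr_Delta_tilde a_gt0) E.
Qed.

Lemma nba_equiv_shift1 a : positive_seq a ->
  nba_equiv (seq_lattice (R := R) a) (seq_lattice (shift_seq 1 a)).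
Proof.
move=> a_gt0; rewrite !seq_latticeE form_lattice_shift1 //.
have h1 := Delta_itv a_gt0.
have /andP[h2 h3] := Delta_tilde_itv a_gt0.
have h4 : 0 <= (a 0)%:R :> R by [].
have /andP[h5 h6] := Delta_tilde_itv (positive_shift 1 a_gt0).
have h7 := Delta_gt1 (positive_shift 1 a_gt0).
apply: nba_equiv_form; rewrite ?oner_eq0 ?mul1r //.
- by rewrite subr_eq0 lt_eqF //; case/andP: h1.
- by rewrite subr_eq0 gt_eqF //; apply: lt_le_trans h4.
- by rewrite gt_eqF //; lra.
Qed.

Lemma nba_equiv_shift a m : positive_seq a ->
  nba_equiv (seq_lattice (R := R) a) (seq_lattice (shift_seq m a)).
Proof.
have nat_shift n b : positive_seq b ->
    nba_equiv (seq_lattice (R := R) b) (seq_lattice (shift_seq n%:Z b)).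
  move=> b_gt0; elim: n => [|n IH].
    rewrite shift_seq0 seq_latticeE.
    apply: nba_equiv_form; rewrite ?oner_eq0 //.
    have := Delta_gt1 b_gt0; have /andP[_ +] := Delta_tilde_itv b_gt0.
    by move=> ? ?; rewrite gt_eqF //; lra.
  apply: nba_equiv_trans IH _; rewrite -[n.+1]add1n PoszD -shift_seqD.
  exact/nba_equiv_shift1/positive_shift.
move=> a_gt0; case: m => n; first exact: nat_shift.
apply: nba_equiv_sym.
rewrite -[X in nba_equiv _ (seq_lattice X)]shift_seq0 -(addrN n.+1%:Z).
rewrite -shift_seqD -NegzE.
exact/nat_shift/positive_shift.
Qed.

(** Reversal exchanges the two coordinates. *)
Lemma nba_equiv_reverse a : positive_seq a ->
  nba_equiv (seq_lattice (R := R) a) (seq_lattice (reverse_seq a)).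
Proof.
move=> a_gt0; apply/nba_equivP; split.
  by case: (irrational_seq_lattice a_gt0).
exists (mx2 0 1 1 0).
  by exists 1, 1; rewrite mulr1 oner_eq0; split=> //; right.
rewrite !seq_latticeE Delta_reverse // Delta_tilde_reverse //.
rewrite -(form_lattice_reflect 1 1 _ _ (a 0)) !form_latticeE -lattice_mull.
rewrite mul_mx2.
by congr (lattice (mx2 _ _ _ _)); ring.
Qed.

Lemma seq_equiv_positive a b :
  seq_equiv a b -> positive_seq a -> positive_seq b.
Proof.
elim=> {a b} [a _ [m|]|//|a b c _ IH1 _ IH2 a_gt0].
- by move=> a_gt0 i; exact: a_gt0.
- by move=> a_gt0 i; exact: a_gt0.
- exact/IH2/IH1.
Qed.

Lemma seq_equiv_sym a b : seq_equiv a b -> seq_equiv b a.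
Proof.
elim=> {a b} [a _ [m|]|a|a b c _ IH1 _ IH2].
- apply: rt_step; rewrite -[X in seq_step _ X]shift_seq0 -(addNr m) -shift_seqD.
  exact: seq_shift.
- apply: rt_step; have {2}-> : a = reverse_seq (reverse_seq a).
    by apply/funext => i; rewrite /reverse_seq opprK.
  exact: seq_reverse.
- exact: rt_refl.
- exact: rt_trans IH2 IH1.
Qed.

Lemma nba_equiv_seq_lattice a b : positive_seq a -> seq_equiv a b ->
  nba_equiv (seq_lattice (R := R) a) (seq_lattice b).
Proof.
move=> + ab; elim: ab => {a b} [a _ [m|]|a|a b c ab IH1 _ IH2] a_gt0.
- exact: nba_equiv_shift.
- exact: nba_equiv_reverse.
- by rewrite -[X in nba_equiv _ (_ X)]shift_seq0; exact: nba_equiv_shift.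
- apply: nba_equiv_trans (IH1 a_gt0) (IH2 _).
  exact: seq_equiv_positive a_gt0.
Qed.

End TwoSidedSequences.

(** * Every irrational lattice comes from a sequence *)

Section Reduction.
Variable R : realType.
Implicit Types (s t c d : R) (n : int).

(** The scale factors c' and d' vary with c and d while the sequence does not,
    which lets the property pass through changes of basis. *)
Definition coded s t := exists2 a : int -> nat, positive_seq a &
  forall c d, c != 0 -> d != 0 -> exists c' d', [/\ c' != 0, d' != 0 &
    form_lattice c d s t = form_lattice c' d' (Delta R a) (Delta_tilde R a)].

Lemma coded_step s t n : irr s -> irr t ->
  coded (s - n%:~R)^-1 (t - n%:~R)^-1 -> coded s t.
Proof.
move=> s_irr t_irr [a a_gt0 code]; exists a => // c d c0 d0.
have sn := irr_neq_int n s_irr; have tn := irr_neq_int n t_irr.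
rewrite (form_lattice_step c d sn tn); apply: code.
  by rewrite mulf_neq0 // subr_eq0 eq_sym.
by rewrite mulf_neq0 // subr_eq0 eq_sym.
Qed.

(** The digits of s are the nonnegative half of the sequence, those of -1/t the
    negative half. *)
Lemma coded_reduced s t : irr s -> irr t -> 1 < s -> -1 < t < 0 -> coded s t.
Proof.
move=> s_irr t_irr s_gt1 /andP[t_gtN1 t_lt0].
have [x x_gt0 xs] := cfrac_surj s_irr s_gt1.
have [y y_gt0 yt] : exists2 y, (forall k, (0 < y k)%N) & cfrac R y = (- t)^-1.
  apply: cfrac_surj.
    have := irr_sub_inv (n := 0) (irrN t_irr).
    by rewrite mulr0z subr0.
  by rewrite invf_gt1; lra.
pose a (i : int) := match i with Posz k => x k | Negz k => y k end.
have a_gt0 : positive_seq a by case.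
exists a => // c d c0 d0; exists c, d; split=> //.
congr form_lattice; first by rewrite -xs.
have -> : t = - (- t)^-1^-1 by rewrite invrK opprK.
by rewrite (Delta_tilde_rec _ a_gt0) -yt.
Qed.

Lemma floor_ge1 s : 1 < s -> 1 <= (Num.floor s)%:~R :> R.
Proof.
by move=> s_gt1; rewrite ler1z -gtz0_ge1 floor_gt0 ltW.
Qed.

Lemma coded_neg s t : irr s -> irr t -> 1 < s -> t < 0 -> coded s t.
Proof.
move=> s_irr t_irr s_gt1 t_lt0.
have /andP[n_lt n_gt] := floor_irr_itv s_irr.
have n_ge1 := floor_ge1 s_gt1.
apply: (coded_step (n := Num.floor s)) => //; apply: coded_reduced.
- exact: irr_sub_inv.
- exact: irr_sub_inv.
- by rewrite invf_gt1; lra.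
- rewrite -[t - _]opprB invrN ltrN2 oppr_lt0 invr_gt0 invf_lt1; last by lra.
  by apply/andP; split; lra.
Qed.

(** One step makes the second number negative and leaves the first above 1; the
    next step then puts the second one into (-1, 0). *)
Lemma coded_below_floor s t : irr s -> irr t -> 1 < s ->
  t < (Num.floor s)%:~R -> coded s t.
Proof.
move=> s_irr t_irr s_gt1 t_lt.
have /andP[n_lt n_gt] := floor_irr_itv s_irr.
apply: (coded_step (n := Num.floor s)) => //; apply: coded_neg.
- exact: irr_sub_inv.
- exact: irr_sub_inv.
- by rewrite invf_gt1; lra.
- by rewrite invr_lt0 subr_lt0.
Qed.

(** One step puts the second number into (0, 1), below the integer part of the
    first. *)
Lemma coded_above_floor s t : irr s -> irr t -> 1 < s ->
  (Num.floor s)%:~R + 1 < t -> coded s t.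
Proof.
move=> s_irr t_irr s_gt1 t_gt.
have /andP[n_lt n_gt] := floor_irr_itv s_irr.
apply: (coded_step (n := Num.floor s)) => //.
have s1_gt1 : 1 < (s - (Num.floor s)%:~R)^-1 by rewrite invf_gt1; lra.
apply: coded_below_floor => //.
- exact: irr_sub_inv.
- exact: irr_sub_inv.
- apply: lt_le_trans (floor_ge1 s1_gt1).
  by rewrite invf_lt1; lra.
Qed.

(** Induction on a bound for 1/|1/s - 1/t|.  If s and t have the same integer
    part n, then 1/s and 1/t are the images of s - n and t - n under the
    contraction 1/(n + _), so the bound drops by 1 when passing to
    1/(s - n) and 1/(t - n). *)
Lemma coded_gt1 s t : irr s -> irr t -> 1 < s -> 1 < t -> s != t -> coded s t.
Proof.
move=> s_irr t_irr s_gt1 t_gt1 st.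
have [N] : exists N : nat, `|s^-1 - t^-1|^-1 < N%:R.
  by exists (Num.bound `|s^-1 - t^-1|^-1); rewrite archi_boundP.
elim: N s t s_irr t_irr s_gt1 t_gt1 st
  => [|N IH] s t s_irr t_irr s_gt1 t_gt1 st.
  by rewrite ltNge invr_ge0 normr_ge0.
move=> st_N.
have /andP[n_lt n_gt] := floor_irr_itv s_irr.
have n_ge1 := floor_ge1 s_gt1.
set n := Num.floor s in n_lt n_gt n_ge1.
case: (ltP t n%:~R) => [|nt]; first exact: coded_below_floor.
case: (ltP (n%:~R + 1) t) => [|tn]; first exact: coded_above_floor.
have t_gt : n%:~R < t by rewrite lt_neqAle nt andbT eq_sym irr_neq_int.
have t_lt : t < n%:~R + 1.
  by rewrite lt_neqAle tn andbT -intrD1 irr_neq_int.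
apply: (coded_step (n := n)) => //; apply: IH.
- exact: irr_sub_inv.
- exact: irr_sub_inv.
- by rewrite invf_gt1; lra.
- by rewrite invf_gt1; lra.
- by apply: contra_neq st => /invr_inj/addIr.
have := @inv_contraction R n%:~R (s - n%:~R) (t - n%:~R) n_ge1.
rewrite !invrK ![_ + (_ - _)]addrC !subrK => /(_ ltac:(lra) ltac:(lra)).
have -> : s - n%:~R - (t - n%:~R) = s - t by ring.
have D_gt0 : 0 < `|s - t| by rewrite normr_gt0 subr_eq0.
have E_gt0 : 0 < `|s^-1 - t^-1|.
  by rewrite normr_gt0 subr_eq0; apply: contra_neq st => /invr_inj.
move: D_gt0 E_gt0 st_N; move: `|s - t| `|s^-1 - t^-1| => D E D_gt0 E_gt0 EN ED.
have : (D / (1 + D))^-1 <= E^-1.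
  by rewrite lef_pV2 // posrE divr_gt0 // addr_gt0.
rewrite invf_div mulrDl mul1r divff ?gt_eqF // => DE.
by move: EN; rewrite -natr1; lra.
Qed.

Lemma coded_irr s t : irr s -> irr t -> s != t -> coded s t.
Proof.
move=> s_irr t_irr st.
have /andP[n_lt n_gt] := floor_irr_itv s_irr.
set n := Num.floor s in n_lt n_gt.
apply: (coded_step (n := n)) => //.
have s1_irr := irr_sub_inv (n := n) s_irr.
have t1_irr := irr_sub_inv (n := n) t_irr.
have s1_gt1 : 1 < (s - n%:~R)^-1 by rewrite invf_gt1; lra.
have n1_ge1 := floor_ge1 s1_gt1.
case: (ltP 1 (t - n%:~R)^-1) => [t1_gt1|t1_le1].
  by apply: coded_gt1 => //; apply: contra_neq st => /invr_inj/addIr.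
apply: coded_below_floor => //; apply: lt_le_trans n1_ge1.
by rewrite lt_neqAle t1_le1 (irr_neq_int 1).
Qed.

(** Irrationality makes the entries of the first column of a generating matrix
    nonzero; dividing the rows by them produces the two linear forms. *)
Lemma irrational_lattice_seq L : irrational_lattice L ->
  exists2 a, positive_seq a & nba_equiv L (seq_lattice (R := R) a).
Proof.
move=> [[A A_unit ->] A_irr].
have inj (z : 'cV[int]_2) : z != 0 ->
    (A *m map_mx intr z) 0 0 != 0 /\ (A *m map_mx intr z) 1 0 != 0.
  move=> z0.
  have := A_irr (A *m map_mx intr z) (A *m map_mx intr 0).
  case=> [||E|].
  - by exists z.
  - by exists 0.
  - have /matrixP Ez := can_inj (mulKmx A_unit) E.
    move/eqP: z0; apply; apply/matrixP => i j.
    by have /eqP := Ez i j; rewrite !mxE eqr_int => /eqP.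
  by rewrite map_mx0 mulmx0 !mxE => /eqP ? /eqP.
pose vecz (x y : int) : 'cV[int]_2 := \col_i if i == 0 then x else y.
have vecz0 x y : (x != 0) || (y != 0) -> vecz x y != 0.
  apply: contraTneq => /matrixP E.
  by have := E 0 0; have := E 1 0; rewrite !mxE /= => -> ->.
have A00 : A 0 0 != 0.
  have [+ _] := inj _ (vecz0 1 0 isT).
  by rewrite mulmx2_row0 !mxE /= mulr0 addr0 mulr1.
have A10 : A 1 0 != 0.
  have [_] := inj _ (vecz0 1 0 isT).
  by rewrite mulmx2_row1 !mxE /= mulr0 addr0 mulr1.
pose s := - (A 0 1 / A 0 0); pose t := - (A 1 1 / A 1 0).
have irr_s : irr s.
  move=> p q pq; apply/eqP; apply/negP => /negP q0.
  have [/eqP + _] := inj (vecz p q) (vecz0 p q ltac:(by rewrite q0 orbT)).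
  by apply; rewrite mulmx2_row0 !mxE /= pq /s; field.
have irr_t : irr t.
  move=> p q pq; apply/eqP; apply/negP => /negP q0.
  have [_ /eqP +] := inj (vecz p q) (vecz0 p q ltac:(by rewrite q0 orbT)).
  by apply; rewrite mulmx2_row1 !mxE /= pq /t; field.
have AE : A = mx2 (A 0 0) (- (A 0 0 * s)) (A 1 0) (- (A 1 0 * t)).
  by apply: mx2P; rewrite !mxE //= /s /t; field.
have st : s != t.
  (* Equal numbers would make the rows of A proportional. *)
  apply/eqP => st; pose M := mx2 (A 1 0) (- A 0 0) 0 0.
  have MA : M *m A = 0.
    rewrite [X in _ *m X]AE st mul_mx2; apply: mx2P; rewrite !mxE /=; ring.
  have := mulmxK A_unit M; rewrite MA mul0mx => /matrixP/(_ 0 0).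
  by rewrite !mxE /= => /esym/eqP; apply/negP.
have [a a_gt0 code] := coded_irr irr_s irr_t st.
exists a => //.
have [c [d [c0 d0 E]]] := code _ _ A00 A10.
rewrite AE -form_latticeE E seq_latticeE; apply: nba_equiv_form => //.
have /andP[_ t_lt0] := Delta_tilde_itv R a_gt0.
by have s_gt1 := Delta_gt1 R a_gt0; rewrite gt_eqF //; lra.
Qed.

End Reduction.

(** * Lattices determine sequences up to shift and reversal *)

Section Uniqueness.
Variable R : realType.
Implicit Types (a b : int -> nat) (c d s t : R) (x y n m : int).

Lemma int_trichotomy x : [\/ x%:~R <= -1 :> R, x = 0 | 1 <= x%:~R :> R].
Proof.
case: (ltgtP x 0) => [x_lt0|x_gt0|->].
- by apply: Or31; rewrite -[-1]/((-1)%:~R) ler_int; lia.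
- by apply: Or33; rewrite ler1z; lia.
- exact: Or32.
Qed.

(** Since s > 0 > t, one of the two forms has no cancellation as soon as x
    and y are both nonzero: it is then at least 1 + s, respectively
    strictly more than 1, in absolute value. On the axes, only the basis
    vectors fit in the box. *)
Lemma unit_box s t x y : 1 < s -> -1 < t < 0 -> (x != 0) || (y != 0) ->
  `|x%:~R - s * y%:~R| <= s -> `|x%:~R - t * y%:~R| <= 1 ->
  `|x%:~R - s * y%:~R| = 1 /\ `|x%:~R - t * y%:~R| = 1 \/
  `|x%:~R - s * y%:~R| = s /\ `|x%:~R - t * y%:~R| = - t.
Proof.
move=> s_gt1 /andP[t_gtN1 t_lt0].
rewrite !ler_norml => xy0 /andP[h1 h2] /andP[h3 h4].
case: (int_trichotomy x) => [X|x0|X]; case: (int_trichotomy y) => [Y|y0|Y].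
- by exfalso; nra.
- left; subst y; rewrite mulr0z !mulr0 !subr0.
  rewrite mulr0z !mulr0 !subr0 in h1 h2 h3 h4.
  by rewrite ler0_norm; lra.
- by exfalso; nra.
- right; subst x; rewrite mulr0z !sub0r !normrN !normrM.
  rewrite mulr0z !sub0r in h1 h2 h3 h4.
  have yE : y%:~R = -1 :> R by nra.
  by rewrite yE normrN1 !mulr1 gtr0_norm ?ltr0_norm //; lra.
- by move: xy0; rewrite x0 y0 eqxx.
- right; subst x; rewrite mulr0z !sub0r !normrN !normrM.
  rewrite mulr0z !sub0r in h1 h2 h3 h4.
  have yE : y%:~R = 1 :> R by nra.
  by rewrite yE normr1 !mulr1 gtr0_norm ?ltr0_norm //; lra.
- by exfalso; nra.
- left; subst y; rewrite mulr0z !mulr0 !subr0.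
  rewrite mulr0z !mulr0 !subr0 in h1 h2 h3 h4.
  by rewrite ger0_norm; lra.
- by exfalso; nra.
Qed.

Lemma form_box c d s t (p : 'cV[R]_2) : c != 0 -> d != 0 ->
  1 < s -> -1 < t < 0 -> form_lattice c d s t p -> p 0 0 != 0 ->
  `|p 0 0| <= `|c| * s -> `|p 1 0| <= `|d| ->
  `|p 0 0| = `|c| /\ `|p 1 0| = `|d| \/
  `|p 0 0| = `|c| * s /\ `|p 1 0| = `|d| * - t.
Proof.
move=> c0 d0 s_gt1 t_itv [x [y ->]]; rewrite vec2_0 vec2_1 !normrM.
have c_gt0 : 0 < `|c| by rewrite normr_gt0.
have d_gt0 : 0 < `|d| by rewrite normr_gt0.
rewrite mulf_eq0 negb_or => /andP[_ p0]; rewrite ler_pM2l //.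
move=> px; rewrite -{2}[`|d|]mulr1 ler_pM2l // => py.
have xy0 : (x != 0) || (y != 0).
  move: p0; apply: contra_neqT; rewrite negb_or !negbK.
  by move=> /andP[/eqP-> /eqP->]; rewrite mulr0z mulr0 subr0.
have [[-> ->]|[-> ->]] := unit_box s_gt1 t_itv xy0 px py; last by right.
by left; rewrite !mulr1.
Qed.

Lemma short_mem c d s t : form_lattice c d s t (vec2 c d).
Proof. by exists 1, 0; rewrite mulr0z !mulr0 !subr0 !mulr1. Qed.

Lemma long_mem c d s t : form_lattice c d s t (vec2 (- c * s) (- d * t)).
Proof. by exists 0, 1; congr vec2; rewrite mulr0z; ring. Qed.

(** Here u = (c, d), v = (-c s, -d t), and u', v' are the vectors for the primed
    data.  Depending on which of the second coordinates of v' and u is larger,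
    either v' lies in the box of (u, v), where only +-v have such a
    long first coordinate, or u lies in the box of (u', v'), whose points all
    have other coordinates.  So v' = +-v, and the second coordinates of u and u'
    give u' = +-u in the same way. *)
Lemma reduced_frame_unique c d s t c' d' s' t' :
  c != 0 -> d != 0 -> c' != 0 -> d' != 0 ->
  1 < s -> -1 < t < 0 -> 1 < s' -> -1 < t' < 0 ->
  form_lattice c d s t = form_lattice c' d' s' t' ->
  `|c| < `|c'| * s' -> `|c'| * s' <= `|c| * s -> s = s' /\ t = t'.
Proof.
move=> c0 d0 c0' d0' s1 t1 s1' t1' E lt_c le_c.
have Nt_lt1' : - t' <= 1 by case/andP: t1' => *; lra.
have t_lt0' : t' < 0 by case/andP: t1'.
have s_gt0' : 0 < s' by lra.
have c_gt0 : 0 < `|c| by rewrite normr_gt0.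
have d_gt0 : 0 < `|d| by rewrite normr_gt0.
have c_gt0' : 0 < `|c'| by rewrite normr_gt0.
have v0 : - c' * s' != 0 by rewrite mulf_eq0 oppr_eq0 negb_or c0' gt_eqF.
have ns : `|- c' * s'| = `|c'| * s'.
  by rewrite normrM normrN (gtr0_norm (x := s')).
have nt : `|- d' * t'| = `|d'| * - t'.
  by rewrite normrM normrN (ltr0_norm (x := t')).
have box := form_box c0 d0 s1 t1; have box' := form_box c0' d0' s1' t1'.
have u_mem : form_lattice c' d' s' t' (vec2 c d).
  by rewrite -E; exact: short_mem.
have u_mem' : form_lattice c d s t (vec2 c' d').
  by rewrite E; exact: short_mem.
have v_mem' : form_lattice c d s t (vec2 (- c' * s') (- d' * t')).
  by rewrite E; exact: long_mem.
have u_box := box' _ u_mem; rewrite vec2_0 vec2_1 in u_box.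
have u_box' := box _ u_mem'; rewrite vec2_0 vec2_1 in u_box'.
have v_box' := box _ v_mem'; rewrite vec2_0 vec2_1 ns nt in v_box'.
have long_eq : `|c'| * s' = `|c| * s /\ `|d'| * - t' = `|d| * - t.
  case: (lerP (`|d'| * - t') `|d|) => dt.
    by case: (v_box' v0 le_c dt) => -[] // e; rewrite e ltxx in lt_c.
  have dd' : `|d| < `|d'| by apply: lt_le_trans dt _; rewrite ler_piMr.
  case: (u_box c0 (ltW lt_c) (ltW dd')) => -[e1 e2].
    by rewrite e2 ltxx in dd'.
  by rewrite e1 ltxx in lt_c.
have short_eq : `|c| = `|c'| /\ `|d| = `|d'|.
  case: (lerP `|d| `|d'|) => dd.
    by case: (u_box c0 (ltW lt_c) dd) => -[] // e; rewrite e ltxx in lt_c.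
  have cc' : `|c'| <= `|c| * s.
    by apply: le_trans le_c; rewrite ler_peMr // ltW.
  case: (u_box' c0' cc' (ltW dd)) => -[e1 e2]; first by [].
  by move: le_c; rewrite -e1 ger_pMr // leNgt s1'.
case: long_eq short_eq => l1 l2 [e1 e2]; split.
  by apply: (mulfI (lt0r_neq0 c_gt0)); rewrite -l1 e1.
by apply: oppr_inj; apply: (mulfI (lt0r_neq0 d_gt0)); rewrite -l2 e2.
Qed.

(** The second scale factor is quantified away because the position in the chain
    of bases is measured by the first coordinate alone. *)
Definition framed L a c := c != 0 /\ exists2 d, d != 0 &
  L = form_lattice c d (Delta R a) (Delta_tilde R a).

Lemma framed_next L a c : positive_seq a -> framed L a c ->
  exists2 c', framed L (shift_seq 1 a) c' &
    `|c'| * Delta R (shift_seq 1 a) = `|c|.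
Proof.
move=> a_gt0 [c0 [d d0 ->]].
have /andP[D_gt _] := Delta_itv R a_gt0.
have /andP[_ t_lt0] := Delta_tilde_itv R a_gt0.
have a0_ge0 : 0 <= (a 0)%:R :> R by [].
exists (c * ((a 0)%:R - Delta R a)).
  split; first by rewrite mulf_neq0 // subr_eq0 lt_eqF.
  exists (d * ((a 0)%:R - Delta_tilde R a)); last exact: form_lattice_shift1.
  by rewrite mulf_neq0 // subr_eq0 gt_eqF //; lra.
rewrite normrM Delta_shift1 // (ltr0_norm (x := _ - _)) ?subr_lt0 //.
rewrite opprB mulfK //.
by rewrite subr_eq0 gt_eqF.
Qed.

Lemma framed_prev L a c : positive_seq a -> framed L a c ->
  exists2 c', framed L (shift_seq (- 1) a) c' & `|c'| = `|c| * Delta R a.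
Proof.
move=> a_gt0 [c0 [d d0 LE]].
have D_gt1 := Delta_gt1 R a_gt0.
have /andP[_ t_lt0] := Delta_tilde_itv R a_gt0.
exists (- c * Delta R a).
  2: by rewrite normrM normrN (gtr0_norm (x := Delta R a)) //; lra.
split; first by rewrite mulf_neq0 ?oppr_eq0 // gt_eqF //; lra.
exists (- d * Delta_tilde R a).
  by rewrite mulf_eq0 oppr_eq0 negb_or d0 lt_eqF.
have b_gt0 := positive_shift (- 1) a_gt0.
have ab : shift_seq 1 (shift_seq (- 1) a) = a.
  by rewrite shift_seqD subrr shift_seq0.
have := Delta_shift1 R b_gt0; have := Delta_tilde_shift1 R b_gt0.
rewrite form_lattice_shift1 // ab => tE DE.
have D0 : Delta R (shift_seq (- 1) a) - (shift_seq (- 1) a 0)%:R != 0.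
  by rewrite -invr_eq0 -DE gt_eqF //; lra.
have t0 : Delta_tilde R (shift_seq (- 1) a) - (shift_seq (- 1) a 0)%:R != 0.
  by rewrite -invr_eq0 -tE lt_eqF.
by rewrite LE; congr form_lattice; [rewrite DE; field|rewrite tE; field].
Qed.

(** Going back by two places at least doubles the scale. *)
Lemma framed_large L a c (e : R) : positive_seq a -> framed L a c ->
  exists m c', framed L (shift_seq m a) c' /\ e <= `|c'|.
Proof.
move=> a_gt0 Fc; have c_gt0 : 0 < `|c| by rewrite normr_gt0; case: Fc.
have [N] : exists N : nat, e / `|c| < 2 ^+ N.
  by exists (Num.bound (e / `|c|)); exact: upper_nthrootP.
rewrite ltr_pdivrMr //.
elim: N a c a_gt0 Fc c_gt0 => [|N IH] a c a_gt0 Fc c_gt0 eN.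
  by exists 0, c; rewrite shift_seq0; split=> //; rewrite expr0 in eN; lra.
have b_gt0 := positive_shift (- 1) a_gt0.
have [c1 F1 c1E] := framed_prev a_gt0 Fc.
have [c2 F2 c2E] := framed_prev b_gt0 F1.
have gt2 := Delta_mul_shift1 R b_gt0.
rewrite shift_seqD subrr shift_seq0 in gt2.
have c2_ge : 2 * `|c| <= `|c2|.
  by rewrite c2E c1E -mulrA mulrC ler_pM2l // mulrC ltW.
have [||m [c' [F' c'_ge]]] := IH _ _ (positive_shift (- 1) b_gt0) F2.
- by lra.
- apply: lt_le_trans eN _; rewrite exprSr -mulrA ler_wpM2l //.
by exists (m - 1 - 1), c'; rewrite -!shift_seqD.
Qed.

(** Starting from a basis that is too long in the first coordinate, shift
    forward until the short vector drops below e. As the short vector of a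
    basis is the long vector of the next one, the first time this happens
    the long vector is still at least e. *)
Lemma framed_interlaced L a c (e : R) :
  0 < e -> positive_seq a -> framed L a c ->
  exists m c', [/\ framed L (shift_seq m a) c', `|c'| < e &
    e <= `|c'| * Delta R (shift_seq m a)].
Proof.
move=> e_gt0 a_gt0 Fc.
have [m [c' [F' c'_ge]]] := framed_large e a_gt0 Fc.
suff main N b c1 : positive_seq b -> framed L b c1 ->
    e <= `|c1| * Delta R b -> `|c1| < e * 2 ^+ N ->
    exists m c', [/\ framed L (shift_seq m b) c', `|c'| < e &
      e <= `|c'| * Delta R (shift_seq m b)].
  have b_gt0 := positive_shift m a_gt0.
  have [N c'N] : exists N : nat, `|c'| / e < 2 ^+ N.
    by exists (Num.bound (`|c'| / e)); exact: upper_nthrootP.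
  have [||k [c2 [F2 lt2 le2]]] := main N _ _ b_gt0 F'.
  - by apply: le_trans c'_ge _; rewrite ler_peMr // ltW // Delta_gt1.
  - by rewrite mulrC -ltr_pdivrMr.
  by exists (k + m), c2; rewrite -shift_seqD.
elim: N b c1 => [|N IH] b c1 b_gt0 F1 le1 ltN.
  by exists 0, c1; rewrite shift_seq0; split=> //; rewrite expr0 mulr1 in ltN.
case: (ltP `|c1| e) => [lt1|ge1]; first by exists 0, c1; rewrite shift_seq0.
have b1_gt0 := positive_shift 1 b_gt0.
have [c2 F2 c2E] := framed_next b_gt0 F1.
case: (ltP `|c2| e) => [lt2|ge2]; first by exists 1, c2; rewrite c2E.
have [c3 F3 c3E] := framed_next b1_gt0 F2.
have [||k [c4 [F4 lt4 le4]]] := IH _ _ (positive_shift 1 b1_gt0) F3.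
- by rewrite c3E.
- have gt2 := Delta_mul_shift1 R b1_gt0.
  have c3_ge0 := normr_ge0 c3.
  have : 2 * `|c3| <= `|c1|.
    by rewrite -c2E -c3E -mulrA mulrC ler_wpM2l // mulrC ltW.
  by move: ltN; rewrite exprS; set P := 2 ^+ N; lra.
by exists (k + 1 + 1), c4; rewrite -!shift_seqD.
Qed.

Lemma form_lattice_shift a b c d : positive_seq a -> positive_seq b ->
  c != 0 -> d != 0 ->
  form_lattice 1 1 (Delta R b) (Delta_tilde R b) =
  form_lattice c d (Delta R a) (Delta_tilde R a) ->
  exists m, b = shift_seq m a.
Proof.
move=> a_gt0 b_gt0 c0 d0 E.
have F : framed (form_lattice 1 1 (Delta R b) (Delta_tilde R b)) a c.
  by split=> //; exists d.
have b_gt1 := Delta_gt1 R b_gt0.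
have [|m [c' [[c0' [d' d0' E']] lt_c le_c]]] :=
    framed_interlaced (e := Delta R b) _ a_gt0 F.
  by lra.
have am_gt0 := positive_shift m a_gt0.
exists m; have [||s_eq t_eq] := reduced_frame_unique c0' d0' (oner_neq0 R)
  (oner_neq0 R) (Delta_gt1 R am_gt0) (Delta_tilde_itv R am_gt0) b_gt1
  (Delta_tilde_itv R b_gt0) (esym E').
- by rewrite normr1 mul1r.
- by rewrite normr1 mul1r.
exact: (Delta_inj (R := R)) (esym t_eq).
Qed.

Lemma seq_equiv_of_nba a b : positive_seq a -> positive_seq b ->
  nba_equiv (seq_lattice (R := R) a) (seq_lattice b) -> seq_equiv a b.
Proof.
move=> a_gt0 b_gt0 /nba_equivP[_ [T [c [d [+ TE]]]]].
rewrite mulf_eq0 negb_or => /andP[c0 d0].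
rewrite !seq_latticeE [in RHS]form_latticeE -lattice_mull => E.
case: TE E => -> E.
  have [|m ->] := form_lattice_shift a_gt0 b_gt0 c0 d0.
    rewrite E form_latticeE mul_mx2; congr (lattice (mx2 _ _ _ _)); ring.
  by apply: rt_step; exact: seq_shift.
have [|m ->] := form_lattice_shift (positive_reverse a_gt0) b_gt0 c0 d0.
  rewrite Delta_reverse // Delta_tilde_reverse //.
  rewrite -(form_lattice_reflect c d _ _ (a 0)) E form_latticeE mul_mx2.
  congr (lattice (mx2 _ _ _ _)); ring.
apply: rt_trans; apply: rt_step; last exact: seq_shift.
exact: seq_reverse.
Qed.

End Uniqueness.

Theorem corollary3p13 (R : realType) :
  exists f : set (int -> nat) -> set (set 'cV[R]_2),
    set_bij seq_classes (nba_classes R) f /\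
    (forall a : int -> nat, positive_seq a ->
       f (seq_class a) = nba_class (seq_lattice a)).
Proof.
(* A class of sequences is sent to the union of the lattice classes of its
   members, so that no representative has to be chosen. *)
pose f (C : set (int -> nat)) : set (set 'cV[R]_2) :=
  [set L | irrational_lattice L /\
    exists2 b, C b & nba_equiv (seq_lattice b) L].
have fE a : positive_seq a -> f (seq_class a) = nba_class (seq_lattice a).
  move=> a_gt0; apply/seteqP; split=> L [L_irr].
    case=> b [b_gt0 ab] bL; split=> //.
    exact: nba_equiv_trans (nba_equiv_seq_lattice R a_gt0 ab) bL.
  by move=> aL; split=> //; exists a => //; split=> //; exact: rt_refl.
exists f; split=> //; split.
- move=> _ [a a_gt0 <-]; rewrite -/(seq_class a) fE //.
  by exists (seq_lattice a) => //; exact: irrational_seq_lattice.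
- move=> C C'; rewrite !inE => -[a a_gt0 <-] [b b_gt0 <-].
  rewrite -!/(seq_class _) !fE // => E.
  have ab : seq_equiv a b.
    apply: (seq_equiv_of_nba (R := R)) => //.
    suff : nba_class (seq_lattice a) (seq_lattice (R := R) b) by case.
    rewrite E; split; first exact: irrational_seq_lattice.
    by have := nba_equiv_shift R 0 b_gt0; rewrite shift_seq0.
  apply/seteqP; split=> e [e_gt0 ee]; split=> //.
    exact: rt_trans (seq_equiv_sym ab) ee.
  exact: rt_trans ab ee.
- move=> _ [L L_irr <-]; have [a a_gt0 La] := irrational_lattice_seq L_irr.
  exists (seq_class a); first by exists a.
  rewrite fE //; apply/seteqP; split=> M [M_irr HM]; split=> //.
    exact: nba_equiv_trans La HM.
  exact: nba_equiv_trans (nba_equiv_sym La) HM.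
Qed.
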